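(* Let $G$ be a well-covered graph without isolated vertices. The following assertions are equivalent: (i) $G$ belongs to the class $\mathbf{W}_2$; (ii) the differential is monotone on independent sets: if $A\subseteq B$ and $B$ is independent, then $\partial(A)\le\partial(B)$; (iii) every vertex of $G$ is a shedding vertex; (iv) there is no independent set $S$ of $G$ such that $G-N_G[S]$ has an isolated vertex; (v) $G-N_G[v]\in\mathbf{W}_2$ for every $v\in V(G)$.
   Context: Graphs are finite, simple, undirected. An independent set is a set of pairwise non-adjacent vertices; a maximum independent set is one of largest size. A graph is well-covered if all its maximal (by inclusion) independent sets have the same cardinality. A graph belongs to $\mathbf{W}_2$ if every two disjoint independent sets are included, respectively, in two disjoint maximum independent sets; by convention the graph with empty vertex set belongs to $\mathbf{W}_2$. For $A\subseteq V(G)$, $N(A)=\{v: N(v)\cap A\ne\emptyset\}$, $N[A]=N(A)\cup A$, $N[v]=N[\{v\}]$, $G-U$ is the subgraph induced by $V(G)\setminus U$, and $\partial(A)=|N(A)\setminus A|-|A|$. A vertex $v$ is a shedding vertex of $G$ if for every independent set $S$ of $G-N[v]$ there exists $u\in N(v)$ such that $S\cup\{u\}$ is independent. *)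

(* Defs.v *)
From mathcomp Require Import all_boot all_order all_algebra.

Set Implicit Arguments.
Unset Strict Implicit.
Unset Printing Implicit Defensive.

Record sgraph := SGraph {
  vertex :> finType;
  edge : rel vertex;
  edge_sym : symmetric edge;
  edge_irrefl : irreflexive edge
}.

Definition open_neigh (G : sgraph) (v : G) : {set G} := [set u | edge v u].

Definition neigh (G : sgraph) (A : {set G}) : {set G} :=
  [set v | open_neigh v :&: A != set0].

Definition cneigh (G : sgraph) (A : {set G}) : {set G} := neigh A :|: A.

Section Induced.
Variables (G : sgraph) (W : {set G}).

Definition induced_edge : rel {x : G | x \in W} :=
  fun x y => edge (val x) (val y).

Fact induced_edge_sym : symmetric induced_edge.
Proof. by move=> x y; apply: edge_sym. Qed.

Fact induced_edge_irrefl : irreflexive induced_edge.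
Proof. by move=> x; apply: edge_irrefl. Qed.

Definition induced : sgraph := SGraph induced_edge_sym induced_edge_irrefl.
End Induced.

Definition remove (G : sgraph) (U : {set G}) : sgraph := induced (~: U).

(* Allowing x = y is harmless, since edges are irreflexive. *)
Definition independent (G : sgraph) (S : {set G}) : bool :=
  [forall x in S, forall y in S, ~~ edge x y].

Definition maximum_independent (G : sgraph) (S : {set G}) : Prop :=
  independent S /\ forall J : {set G}, independent J -> #|J| <= #|S|.

Definition well_covered (G : sgraph) : Prop :=
  forall I J : {set G},
    maxset (@independent G) I -> maxset (@independent G) J -> #|I| = #|J|.

Definition isolated (G : sgraph) (v : G) : Prop := open_neigh v = set0.

(* The graph with no vertices satisfies this definition, in agreement with the
   usual convention. *)
Definition W2 (G : sgraph) : Prop :=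
  forall A B : {set G}, independent A -> independent B -> [disjoint A & B] ->
    exists X Y : {set G},
      [/\ maximum_independent X, maximum_independent Y,
          A \subset X, B \subset Y & [disjoint X & Y]].

Definition differential (G : sgraph) (A : {set G}) : int :=
  (#|neigh A :\: A|%:Z - #|A|%:Z)%R.

(* S lives in the subgraph G - N[v], so its image under val is the
   corresponding set of vertices of G. *)
Definition shedding (G : sgraph) (v : G) : Prop :=
  forall S : {set remove (cneigh [set v])}, independent S ->
    exists2 u : G, u \in open_neigh v & independent ([set val x | x in S] :|: [set u]).

(* Main.v *)
Require Import Defs.
From mathcomp Require Import all_boot all_order all_algebra.

(** All five assertions are equivalent to [nonisolating]: a vertex outside the
    closed neighbourhood of an independent set keeps a neighbour outside it.
    Under this condition, let X be an inclusion-maximal independent set that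
    contains A and avoids the independent set B. Were X not maximal in G, some
    b in B could be added; deleting N[X] and the rest of B leaves b a neighbour,
    which lies outside B and could be added to X. Well-coveredness makes such
    an X maximum, and applying this twice gives W2.
    For the differential, a maximum independent set Y that contains A and
    avoids B \ A satisfies |N(B) :&: Y| >= |B \ A|, as otherwise
    (Y \ N(B)) :|: B would be a larger independent set. *)

Set Implicit Arguments.
Unset Strict Implicit.
Unset Printing Implicit Defensive.

Definition nonisolating (G : sgraph) : Prop :=
  forall (S : {set G}) (x : G), independent S -> x \notin cneigh S ->
    exists2 y, edge x y & y \notin cneigh S.

Lemma disjointsU1 (T : finType) (x : T) (A B : {set T}) :
  [disjoint x |: A & B] = (x \notin B) && [disjoint A & B].
Proof. by rewrite -!setI_eq0 setIUl setU_eq0 !setI_eq0 disjoints1. Qed.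

(** * Neighbourhoods and independent sets *)

Section Graph.
Variable G : sgraph.
Implicit Types (A B S X Y : {set G}) (u v x y : G).

Lemma independentP S :
  reflect {in S &, forall x y, ~~ edge x y} (independent S).
Proof.
apply: (iffP forall_inP) => [h x y xS yS | h x xS].
  by have /forall_inP := h x xS; apply.
by apply/forall_inP => y yS; apply: h.
Qed.

Lemma neighP S x : reflect (exists2 y, y \in S & edge x y) (x \in neigh S).
Proof.
rewrite inE; apply: (iffP (set0Pn _)) => [[y] | [y yS exy]].
  by rewrite !inE => /andP [exy yS]; exists y.
by exists y; rewrite !inE exy.
Qed.

Lemma cneigh1E v x : (x \in cneigh [set v]) = edge v x || (x == v).
Proof.
rewrite !inE; congr (_ || _); apply/set0Pn/idP => [[y] | evx].
  by rewrite !inE => /andP [exy /eqP <-]; rewrite edge_sym.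
by exists v; rewrite !inE edge_sym evx eqxx.
Qed.

Lemma notin_cneigh S x :
  x \notin cneigh S -> x \notin S /\ {in S, forall y, ~~ edge x y}.
Proof.
rewrite inE negb_or => /andP [xNS xS]; split=> // y yS.
by apply: contra xNS => exy; apply/neighP; exists y.
Qed.

Lemma neighS A B : A \subset B -> neigh A \subset neigh B.
Proof.
move=> /subsetP sAB; apply/subsetP => x /neighP [y yA exy].
by apply/neighP; exists y => //; apply: sAB.
Qed.

Lemma neighU A B : neigh (A :|: B) = neigh A :|: neigh B.
Proof. by apply/setP=> x; rewrite !inE setIUr setU_eq0 negb_and. Qed.

Lemma cneighU A B : cneigh (A :|: B) = cneigh A :|: cneigh B.
Proof. by rewrite /cneigh neighU setUACA. Qed.

Lemma independentS A B : A \subset B -> independent B -> independent A.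
Proof.
move=> /subsetP sAB /independentP iB.
by apply/independentP => x y /sAB xB /sAB; apply: iB.
Qed.

(** Turns the differential of an independent set into |N(S)| - |S|. *)
Lemma independent_neighD S : independent S -> neigh S :\: S = neigh S.
Proof.
move/independentP => iS; apply/setDidPl; rewrite disjoint_subset.
apply/subsetP => x /neighP [y yS exy]; apply/negP => xS.
by have := iS _ _ xS yS; rewrite exy.
Qed.

Lemma independentU A B : independent A -> independent B ->
  {in A & B, forall x y, ~~ edge x y} -> independent (A :|: B).
Proof.
move=> /independentP iA /independentP iB iAB.
apply/independentP => x y /setUP [] xS /setUP [] yS.
- exact: iA.
- exact: iAB.
- by rewrite edge_sym; apply: iAB.
- exact: iB.
Qed.

Lemma independent1 x : independent [set x].
Proof. by apply/independentP => y z /set1P -> /set1P ->; rewrite edge_irrefl. Qed.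

Lemma independentU1 S x :
  independent S -> x \notin cneigh S -> independent (x |: S).
Proof.
move=> iS /notin_cneigh [_ xS]; apply: independentU => //.
  exact: independent1.
by move=> _ y /set1P -> /xS.
Qed.

(** * Maximum independent sets and the class W2 *)

Lemma maximum_independent_cneigh X :
  maximum_independent X -> cneigh X = setT.
Proof.
move=> [iX mX]; apply/setP => x; rewrite [RHS]inE; apply/negPn/negP => xX.
have [xNX _] := notin_cneigh xX.
by have := mX _ (independentU1 iX xX); rewrite cardsU1 xNX ltnn.
Qed.

(** Every vertex outside [X] has a neighbour in [X], so [X] is maximal by inclusion and has the size
    of any maximal set containing [J]. *)
Lemma well_covered_maximum X : well_covered G ->
  independent X -> cneigh X = setT -> maximum_independent X.
Proof.
move=> wcG iX cX; split=> // J iJ.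
have [K mK sJK] := maxset_exists iJ.
suff mX : maxset (@independent G) X.
  by rewrite (wcG _ _ mX mK); apply: subset_leq_card.
apply/maxsetP; split=> // Y /independentP iY sXY.
apply/eqP; rewrite eqEsubset sXY andbT; apply/subsetP => y yY.
have : y \in cneigh X by rewrite cX inE.
case/setUP => // /neighP [x xX eyx].
by have := iY _ _ yY (subsetP sXY _ xX); rewrite eyx.
Qed.

(** Extend [S] and {x} to disjoint maximum sets [X] and [Y]. As [x] is not in [X], it has a
    neighbour in [X], and independence of [X] keeps that neighbour out of N(S). *)
Lemma W2_nonisolating : W2 G -> nonisolating G.
Proof.
move=> w S x iS xS; have [xNS xE] := notin_cneigh xS.
have d : [disjoint S & [set x]] by rewrite disjoint_sym disjoints1.
have [X [Y [mX _ sSX xY dXY]]] := w _ _ iS (independent1 x) d.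
have xX : x \notin X.
  by rewrite (disjointFl dXY) // (subsetP xY) ?set11.
have : x \in cneigh X by rewrite (maximum_independent_cneigh mX) inE.
rewrite inE (negbTE xX) orbF => /neighP [y yX exy]; exists y => //.
rewrite inE negb_or; apply/andP; split.
  apply/negP => /neighP [z zS eyz]; have /independentP iX := mX.1.
  by have := iX _ _ yX (subsetP sSX _ zS); rewrite eyz.
by apply: contraL exy => /xE.
Qed.

Lemma nonisolating_extend A B : well_covered G -> nonisolating G ->
  independent A -> independent B -> [disjoint A & B] ->
  exists X, [/\ maximum_independent X, A \subset X & [disjoint X & B]].
Proof.
move=> wcG niG iA iB dAB.
pose P X := independent X && [disjoint X & B].
have PA : P A by rewrite /P iA.
have [X /maxsetP [/andP [iX dXB] mX] sAX] := maxset_exists PA.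
exists X; split=> //; apply: well_covered_maximum => //.
apply/setP => x; rewrite [RHS]inE; apply/negPn/negP => xX.
(* By maximality among independent sets avoiding [B], any vertex that could still be added to [X]
   lies in [B]. *)
have addX y : y \notin cneigh X -> y \in B.
  move=> yX; apply/negPn/negP => yB; have [yNX _] := notin_cneigh yX.
  have : P (y |: X).
    by rewrite /P independentU1 //= disjointsU1 yB.
  move/mX => /(_ (subsetUr _ _)) eX.
  by case/negP: yNX; rewrite -eX setU11.
have xB := addX _ xX.
set C := [set b in B | (b \notin cneigh X) && (b != x)].
have sCB : C \subset B by apply/subsetP => b; rewrite inE => /andP [].
have iC := independentS sCB iB.
have iXC : independent (X :|: C).
  apply: independentU => // y b yX; rewrite inE => /and3P [_ bX _].
  by rewrite edge_sym; apply: (notin_cneigh bX).2.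
have xC : x \notin cneigh (X :|: C).
  rewrite cneighU in_setU (negbTE xX) /= inE negb_or !inE eqxx !andbF andbT.
  apply/negP => /set0Pn [b]; rewrite !inE => /andP [exb /andP [bB _]].
  by move/independentP: iB => /(_ _ _ xB bB); rewrite exb.
(* The neighbour [y] of [x] is outside N[X], hence in [B], although [x] is in the independent set
   [B] too. *)
have [y exy] := niG _ _ iXC xC.
rewrite cneighU in_setU negb_or => /andP [/addX yB _].
by move/independentP: iB => /(_ _ _ xB yB); rewrite exy.
Qed.

Lemma nonisolating_W2 : well_covered G -> nonisolating G -> W2 G.
Proof.
move=> wcG niG A B iA iB dAB.
have [X [mX sAX dXB]] := nonisolating_extend wcG niG iA iB dAB.
(* The second extension avoids all of [X], which makes the two maximum sets disjoint. *)
have dBX : [disjoint B & X] by rewrite disjoint_sym.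
have [Y [mY sBY dYX]] := nonisolating_extend wcG niG iB mX.1 dBX.
by exists X, Y; split=> //; rewrite disjoint_sym.
Qed.

(** * Monotonicity of the differential *)

Lemma maximum_independent_card_neigh B Y : independent B ->
  maximum_independent Y -> #|B :\: Y| <= #|neigh B :&: Y|.
Proof.
move=> iB [iY mY].
(* This is (Y \ N(B)) ∪ B as a disjoint union: [B] is independent, so B ∩ Y misses N(B). *)
have iZ : independent ((Y :\: neigh B) :|: (B :\: Y)).
  apply: independentU; [exact: independentS (subsetDl _ _) iY| |].
    exact: independentS (subsetDl _ _) iB.
  move=> y b /setDP [_ yB] /setDP [bB _].
  by apply: contra yB => eyb; apply/neighP; exists b.
have := mY _ iZ; rewrite cardsU.
have -> : (Y :\: neigh B) :&: (B :\: Y) = set0.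
  by apply/setP=> z; rewrite !inE; case: (z \in Y); rewrite ?andbF.
rewrite cards0 subn0 -(cardsID (neigh B) Y) addnC leq_add2r.
by rewrite setIC.
Qed.

Lemma W2_differential A B : W2 G -> A \subset B -> independent B ->
  (differential A <= differential B)%R.
Proof.
move=> w sAB iB; have iA := independentS sAB iB.
have iD : independent (B :\: A) := independentS (subsetDl _ _) iB.
have dAD : [disjoint A & B :\: A].
  by rewrite -setI_eq0 setIDA setDIl setDv set0I.
have [Y [Z [mY _ sAY sDZ dYZ]]] := w _ _ iA iD dAD.
rewrite /differential !independent_neighD //.
have le1 := maximum_independent_card_neigh iB mY.
have eD : B :\: A \subset B :\: Y.
  apply/subsetP=> x xD; rewrite inE (disjointFl dYZ) ?(subsetP sDZ) //=.
  by case/setDP: xD.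
(* [Y] is independent and contains [A], hence misses N(A). *)
have le2 : #|neigh B :&: Y| <= #|neigh B :\: neigh A|.
  apply/subset_leq_card/subsetP => y /setIP [yB yY]; rewrite inE yB andbT.
  apply/negP => /neighP [a aA eya]; have /independentP iY := mY.1.
  by have := iY _ _ yY (subsetP sAY _ aA); rewrite eya.
have le3 := leq_trans (subset_leq_card eD) (leq_trans le1 le2).
(* Splitting [B] along [A] and N(B) along N(A) gives ∂(B) - ∂(A) = |N(B) \ N(A)| - |B \ A|. *)
have := cardsID A B; rewrite (setIidPr sAB) => <-.
have := cardsID (neigh A) (neigh B); rewrite (setIidPr (neighS sAB)) => <-.
rewrite !PoszD GRing.opprD GRing.addrACA Num.Theory.lerDl.
by rewrite Num.Theory.subr_ge0 lez_nat.
Qed.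

(** Adding [x] to [S] raises the size by one, so by monotonicity N(S) must gain a vertex; this
    vertex is a neighbour of [x], and it is not in [S] because [x] has no neighbour there. *)
Lemma differential_nonisolating :
  (forall A B, A \subset B -> independent B ->
    (differential A <= differential B)%R) -> nonisolating G.
Proof.
move=> mono S x iS xS; have [xNS xE] := notin_cneigh xS.
have ixS := independentU1 iS xS.
have := mono _ _ (subsetUr [set x] S) ixS.
rewrite /differential !independent_neighD // cardsU1 xNS PoszD GRing.opprD.
rewrite GRing.addrA Num.Theory.lerD2r Num.Theory.lerBrDr -PoszD lez_nat addn1.
move=> lt; have /subsetPn [y yxS yS] : ~~ (neigh (x |: S) \subset neigh S).
  by apply: contraL lt => /subset_leq_card; rewrite -leqNgt.
move: yxS; rewrite neighU inE (negbTE yS) orbF => /neighP [_ /set1P ->].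
rewrite edge_sym => exy; exists y => //.
rewrite inE (negbTE yS) /=.
by apply: contraL exy => /xE.
Qed.

End Graph.

(** * Transfer between a graph and its induced subgraphs *)

Section Remove.
Variable G : sgraph.
Implicit Types U S X : {set G}.

Lemma val_removeP U (x : remove U) : val x \notin U.
Proof. by have := valP x; rewrite inE. Qed.

Lemma remove_lift U x : x \notin U -> exists y : remove U, val y = x.
Proof.
move=> xU; have xCU : x \in ~: U by rewrite inE.
by exists (Sub x xCU : {x | x \in ~: U}).
Qed.

Lemma independent_val U (S : {set remove U}) :
  independent [set val x | x in S] = independent S.
Proof.
apply/independentP/independentP => iS x y.
  by move=> xS yS; apply: iS; apply: imset_f.
by move=> /imsetP [a aS ->] /imsetP [b bS ->]; apply: (iS a b).
Qed.

Lemma independent_preim U S :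
  independent S -> independent [set x : remove U | val x \in S].
Proof.
move/independentP => iS; apply/independentP => x y.
by rewrite !inE => xS yS; apply: (iS (val x) (val y)).
Qed.

Lemma cneigh_val U (S : {set remove U}) (x : remove U) :
  (val x \in cneigh [set val z | z in S]) = (x \in cneigh S).
Proof.
rewrite !in_setU mem_imset; last exact: val_inj.
congr (_ || _); apply/neighP/neighP => [[_ /imsetP [z zS ->] e] | [z zS e]].
  by exists z.
by exists (val z); first exact: imset_f.
Qed.

Lemma val_preim U S : [disjoint S & U] ->
  [set val x | x in [set x : remove U | val x \in S]] = S.
Proof.
move=> dSU; apply/setP => x; apply/imsetP/idP => [[y] | xS].
  by rewrite inE => yS ->.
have [y yx] := remove_lift (negbT (disjointFr dSU xS)).
by exists y; rewrite // inE yx.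
Qed.

(** * Shedding vertices and isolated vertices *)

Lemma notin_val_remove (v : G) (S : {set remove (cneigh [set v])}) :
  v \notin [set val x | x in S].
Proof.
apply/imsetP => [[x _ vx]].
by have := val_removeP x; rewrite cneigh1E -vx eqxx orbT.
Qed.

(** Since [x] is outside N[S], [S] lives in G - N[x]; the neighbour [u] of [x] that shedding
    provides is not adjacent to [S]. *)
Lemma shedding_nonisolating : (forall v : G, shedding v) -> nonisolating G.
Proof.
move=> sh S x iS xS; have [xNS xE] := notin_cneigh xS.
have dS : [disjoint S & cneigh [set x]].
  rewrite disjoint_subset; apply/subsetP => y yS.
  rewrite inE cneigh1E negb_or xE //=.
  by apply: contra xNS => /eqP <-.
have [u] := sh x _ (independent_preim (cneigh [set x]) iS).
rewrite val_preim // inE => exu /independentP iSu; exists u => //.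
rewrite inE negb_or; apply/andP; split; last by apply: contraL exu => /xE.
apply/negP => /neighP [y yS euy].
suff: ~~ edge u y by rewrite euy.
by apply: iSu; rewrite !inE ?eqxx ?yS ?orbT.
Qed.

Lemma nonisolating_shedding (v : G) : nonisolating G -> shedding v.
Proof.
move=> niG S iS; have iS' : independent [set val x | x in S].
  by rewrite independent_val.
have vS : v \notin cneigh [set val x | x in S].
  rewrite inE negb_or notin_val_remove andbT.
  apply/negP => /neighP [_ /imsetP [x _ ->] evx].
  by have := val_removeP x; rewrite cneigh1E evx.
have [u evu uS] := niG _ _ iS' vS.
by exists u; rewrite ?inE // setUC; apply: independentU1.
Qed.

(** The vertices of G - N[S] are those outside N[S], so a neighbour there is exactly the one that
    [nonisolating] asks for. *)
Lemma nonisolatingE : nonisolating G <->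
  ~ exists S : {set G}, independent S /\ exists x : remove (cneigh S), isolated x.
Proof.
split=> [niG [S [iS [x isox]]] | h S x iS xS].
  have [y exy /remove_lift [y' y'y]] := niG _ _ iS (val_removeP x).
  have : y' \in open_neigh x by rewrite inE -y'y in exy *.
  by rewrite isox inE.
have [x' x'x] := remove_lift xS.
have /set0Pn [y] : open_neigh x' != set0.
  by apply/eqP => iso; apply: h; exists S; split=> //; exists x'.
by rewrite inE => exy; exists (val y); [rewrite -x'x | exact: val_removeP].
Qed.

(** * Deletion of the closed neighbourhood of a vertex *)

Lemma independent_remove_setU1 (v : G) (S : {set remove (cneigh [set v])}) :
  independent S -> independent (v |: [set val x | x in S]).
Proof.
move=> iS; apply: independentU; [exact: independent1 | by rewrite independent_val |].
move=> _ _ /set1P -> /imsetP [x _ ->].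
by have := val_removeP x; rewrite cneigh1E negb_or => /andP [].
Qed.

(** Restricting [X] loses only [v], while any independent set of G - N[v] gains one element when [v]
    is added. *)
Lemma maximum_independent_remove (v : G) X : maximum_independent X -> v \in X ->
  maximum_independent [set x : remove (cneigh [set v]) | val x \in X].
Proof.
move=> [iX mX] vX; split; first exact: independent_preim.
move=> J iJ; set K := [set x | _].
have cX : #|X| = #|K|.+1.
  rewrite (cardsD1 v) vX add1n; congr _.+1.
  rewrite -(card_imset _ (@val_inj _ _ {x | x \in ~: cneigh [set v]})).
  have -> : K = [set x | val x \in X :\ v].
    apply/setP => x; rewrite !inE; case: eqP => // xv.
    by have := val_removeP x; rewrite cneigh1E xv eqxx orbT.
  rewrite val_preim // disjoint_subset; apply/subsetP => y /setD1P [yv yX].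
  rewrite inE cneigh1E (negbTE yv) orbF.
  by move/independentP: iX; apply.
rewrite -ltnS -cX.
have := mX _ (independent_remove_setU1 iJ).
by rewrite cardsU1 notin_val_remove card_imset //; exact: val_inj.
Qed.

(** Sets are extended in [G], where well-coveredness is given, and then restricted to G - N[v]. *)
Lemma nonisolating_remove_W2 (v : G) : well_covered G -> nonisolating G ->
  W2 (remove (cneigh [set v])).
Proof.
move=> wcG niG.
(* Extend v |: A to a maximum set of G that avoids B, then delete v. *)
have ext (A B : {set remove (cneigh [set v])}) :
    independent A -> independent B -> [disjoint A & B] ->
    exists X : {set remove (cneigh [set v])},
      [/\ maximum_independent X, A \subset X & [disjoint X & B]].
  move=> iA iB dAB.
  have iA' := independent_remove_setU1 iA.
  have iB' : independent [set val x | x in B] by rewrite independent_val.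
  have dAB' : [disjoint v |: [set val x | x in A] & [set val x | x in B]].
    rewrite disjointsU1 notin_val_remove /=.
    by rewrite imset_disjoint //; apply: val_inj.
  have [X [mX sAX dXB]] := nonisolating_extend wcG niG iA' iB' dAB'.
  exists [set x | val x \in X]; split.
  - by apply: maximum_independent_remove; rewrite // (subsetP sAX) ?setU11.
  - apply/subsetP => x xA; rewrite inE (subsetP sAX) // inE.
    by rewrite imset_f ?orbT.
  - rewrite disjoint_subset; apply/subsetP => x; rewrite !inE => xX.
    by apply/negP => xB; move: (disjointFr dXB xX); rewrite imset_f.
move=> A B iA iB dAB.
have [X [mX sAX dXB]] := ext _ _ iA iB dAB.
have dBX : [disjoint B & X] by rewrite disjoint_sym.
have [Y [mY sBY dYX]] := ext _ _ iB mX.1 dBX.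
by exists X, Y; split=> //; rewrite disjoint_sym.
Qed.

(** For empty [S] the neighbour exists because [x] is not isolated. Otherwise pick [v] in [S]: as
    N[S] = N[v] ∪ N[S \ v], the neighbour can be found inside G - N[v], using S \ v there. *)
Lemma remove_W2_nonisolating : ~ (exists v : G, isolated v) ->
  (forall v : G, W2 (remove (cneigh [set v]))) -> nonisolating G.
Proof.
move=> noiso w S x iS xS.
have [S0 | [v vS]] := set_0Vmem S.
  have /set0Pn [y] : open_neigh x != set0.
    by apply/eqP => iso; apply: noiso; exists x.
  rewrite inE => exy; exists y => //.
  rewrite S0 !inE orbF negbK; apply/eqP/setP => z.
  by rewrite !inE andbF.
pose U := cneigh [set v].
have eS : S = v |: (S :\ v) by rewrite setD1K.
move: xS; rewrite eS cneighU in_setU negb_or => /andP [xv xS].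
have dS : [disjoint S :\ v & U].
  rewrite disjoint_subset; apply/subsetP => y /setD1P [yv yS].
  rewrite inE cneigh1E (negbTE yv) orbF.
  by move/independentP: iS; apply.
have [x' x'x] := remove_lift xv.
have iS' := independent_preim U (independentS (subsetDl S [set v]) iS).
have xS' : x' \notin cneigh [set z : remove U | val z \in S :\ v].
  by rewrite -cneigh_val val_preim // x'x.
have [y exy yS] := W2_nonisolating (w v) iS' xS'.
exists (val y); first by rewrite -x'x.
rewrite in_setU negb_or (val_removeP y) /=.
by rewrite -(val_preim dS) cneigh_val.
Qed.

End Remove.

Theorem theorem3p9 (G : sgraph) (wcG : well_covered G)
    (noisoG : ~ exists v : G, isolated v) :
  [<-> W2 G;
       forall A B : {set G}, A \subset B -> independent B ->
         (differential A <= differential B)%R;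
       forall v : G, shedding v;
       ~ exists S : {set G}, independent S /\
           exists x : remove (cneigh S), isolated x;
       forall v : G, W2 (remove (cneigh [set v]))].
Proof.
(* A cycle of implications in the stated order; those after the first pass through
   [nonisolating]. *)
tfae.
- by move=> w A B; apply: W2_differential.
- by move=> /differential_nonisolating niG v; apply: nonisolating_shedding.
- by move=> /shedding_nonisolating /nonisolatingE.
- by move=> /nonisolatingE niG v; apply: nonisolating_remove_W2.
- by move=> /(remove_W2_nonisolating noisoG); apply: nonisolating_W2.
Qed.
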